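(* Let $\mathcal{H}$ be a complex Hilbert space, let $0\leq\alpha\leq1\leq\beta$, and let $T\in\mathcal{B}(\mathcal{H})$ be an $(\alpha,\beta)$-normal operator. Then $$w^2(T)\geq\max\left\{1+\alpha^2,\ 1+\frac{1}{\beta^2}\right\}\frac{\|T\|^2}{4}+\frac{\left|\,\|\Re(T)\|^2-\|\Im(T)\|^2\,\right|}{2}.$$
   Context: $\mathcal{B}(\mathcal{H})$ denotes the $C^*$-algebra of all bounded linear operators on the complex Hilbert space $\mathcal{H}$, and $\|\cdot\|$ is the operator norm. For real numbers $0\leq\alpha\leq1\leq\beta$, an operator $T\in\mathcal{B}(\mathcal{H})$ is called $(\alpha,\beta)$-normal if $\alpha^2T^*T\leq TT^*\leq\beta^2T^*T$ (in the usual order of self-adjoint operators), equivalently $\alpha\|Tx\|\leq\|T^*x\|\leq\beta\|Tx\|$ for all $x\in\mathcal{H}$. The real and imaginary parts of $T$ are $\Re(T)=\frac12(T+T^* )$ and $\Im(T)=\frac{1}{2i}(T-T^* )$. The numerical radius is $w(T)=\sup\{|\langle Tx,x\rangle|: x\in\mathcal{H},\ \|x\|=1\}$, and $w^2(T)=(w(T))^2$. *)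

(* Defs.v *)
From HB Require Import structures.
From mathcomp Require Import all_boot all_order all_algebra.
From mathcomp Require Import sesquilinear complex.
From mathcomp Require Import ring lra.
From mathcomp Require Import all_classical all_reals all_analysis.

Set Implicit Arguments.
Unset Strict Implicit.
Unset Printing Implicit Defensive.

Import Order.TTheory GRing.Theory Num.Theory Num.Def.
Import numFieldNormedType.Exports.

Local Open Scope classical_set_scope.
Local Open Scope ring_scope.
Local Open Scope complex_scope.

(* `hdot` is linear in its first argument and conjugate-linear in its second. *)
HB.mixin Record isHilbert (R : realType) H of CompleteNormedModule R[i] H := {
  hdot : {dot H for @conjC R[i]};
  hdotE : forall x : H, `|x| ^+ 2 = hdot x x
}.

#[short(type="hilbertType")]
HB.structure Definition Hilbert (R : realType) :=
  {H of isHilbert R H & CompleteNormedModule R[i] H}.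

Section Operators.
Context {R : realType} {H : hilbertType R}.
Implicit Types (A B T : H -> H) (x y z : H).

Local Notation "''[' u , v ]" := (hdot u v) : ring_scope.

(* The value `xget 0` picks is unique, as `hdot` is definite; `adjointP` shows
   that it exists when T is bounded (Riesz representation). *)
Definition adjoint T : H -> H :=
  fun y => xget 0 [set z | forall x, '[T x, y] = '[x, z]].

(* Norms are valued in R[i]; `complex.Re` brings them back to R.  `sup` is 0 on
   unbounded sets, but on a bounded operator both sets below are bounded. *)
Definition op_norm T : R :=
  sup [set complex.Re `|T x| | x in [set x | `|x| <= 1]].

(* When H = 0 there is no unit vector and the value is `sup set0 = 0`. *)
Definition num_radius T : R :=
  sup [set complex.Re `|'[T x, x]| | x in [set x | `|x| = 1]].

Definition op_Re T : H -> H := 2^-1 *: (T + adjoint T).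

Definition op_Im T : H -> H := (2 * 'i)^-1 *: (T - adjoint T).

(* In R[i], `0 <= z` says that z is real and nonnegative. *)
Definition op_le A B : Prop := forall x, 0 <= '[(B - A) x, x].

Definition ab_normal (alpha beta : R) T : Prop :=
  op_le ((alpha ^+ 2)%:C *: (adjoint T \o T)) (T \o adjoint T) /\
  op_le (T \o adjoint T) ((beta ^+ 2)%:C *: (adjoint T \o T)).

Lemma hdot_conj (u v : H) : '[u, v] = ('[v, u])^*.
Proof. by rewrite {1}hermC expr0 mul1r. Qed.

Let N2 (u : H) : R := complex.Re '[u, u].
Let B (u v : H) : R := complex.Re '[u, v].

Let N2E u : '[u, u] = (N2 u)%:C.
Proof. by rewrite /N2 RRe_real// ger0_real// dnorm_ge0. Qed.

Let N2_ge0 u : 0 <= N2 u.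
Proof. by rewrite -ler0c -N2E dnorm_ge0. Qed.

Let BC u v : B u v = B v u.
Proof. by rewrite /B hdot_conj; case: (hdot v u). Qed.

Let BD u v w : B (u + v) w = B u w + B v w.
Proof.
by rewrite /B linearDl /=; case: (hdot u w) => a b; case: (hdot v w).
Qed.

Let BZ (t : R) u w : B (t%:C *: u) w = t * B u w.
Proof.
by rewrite /B linearZl_LR /=; case: (hdot u w) => a b /=; rewrite mul0r subr0.
Qed.

Let BN u w : B (- u) w = - B u w.
Proof. by rewrite /B linearNl /=; case: (hdot u w). Qed.

Let Bi u w : B ('i *: u) w = - complex.Im '[u, w].
Proof.
rewrite /B linearZl_LR /=; case: (hdot u w) => a b /=.
by rewrite mul0r mul1r sub0r.
Qed.


Let N2D u v : N2 (u + v) = N2 u + N2 v + 2 * B u v.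
Proof.
rewrite -[N2 _]/(B _ _) BD ![B _ (u + v)]BC !BD (BC v u) -!/(N2 _).
rewrite -[B u u]/(N2 u) -[B v v]/(N2 v); ring.
Qed.

Let N2Z (t : R) u : N2 (t%:C *: u) = t ^+ 2 * N2 u.
Proof. by rewrite -[N2 _]/(B _ _) BZ BC BZ mulrA. Qed.

Let normN2 u : `|u| ^+ 2 = (N2 u)%:C.
Proof. by rewrite hdotE N2E. Qed.

Let discr (a b c : R) : (forall t, 0 <= a + 2 * t * b + t ^+ 2 * c) ->
  0 <= c -> b ^+ 2 <= a * c.
Proof.
move=> h; rewrite le_eqVlt => /orP[/eqP c0|c0].
  have [->|b0] := eqVneq b 0; first by rewrite -c0 expr0n mulr0.
  have := h (- (a + 1) / (2 * b)); rewrite -c0 mulr0 addr0.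
  have -> : a + 2 * (- (a + 1) / (2 * b)) * b = -1 by field.
  by rewrite ler0N1.
have := h (- b / c).
have -> : a + 2 * (- b / c) * b + (- b / c) ^+ 2 * c = (a * c - b ^+ 2) / c.
  by field; rewrite gt_eqF.
by rewrite pmulr_lge0 ?invr_gt0// subr_ge0.
Qed.

Let CS u v : B u v ^+ 2 <= N2 u * N2 v.
Proof.
apply: discr => // t; have := N2_ge0 (u + t%:C *: v).
by rewrite N2D N2Z BC BZ (BC v u); congr (0 <= _); ring.
Qed.

Let sq2 (p q s : R) : p ^+ 2 <= s -> q ^+ 2 <= s -> (p - q) ^+ 2 <= 4 * s.
Proof. by move=> hp hq; have := sqr_ge0 (p + q); rewrite sqrrB sqrrD; lra. Qed.

(* The representing vector is the minimizer of |u|^2 - 2 Re <Tu, y>, obtained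
   as the limit of its sublevel sets, on which the gradient is small (`stat`). *)
Lemma adjointP (T : {linear H -> H}) : continuous T ->
  forall x y, '[T x, y] = '[x, adjoint T y].
Proof.
move=> cT x y; rewrite /adjoint.
suff /(@xgetPex _ 0) : exists z, forall x, '[T x, y] = '[x, z] by exact.
have [K K0 TK] : exists2 K : R, 0 < K & forall u, N2 (T u) <= K * N2 u.
  have /linear_boundedP /pinfty_ex_gt0[r r0 hr] :=
    (linear_bounded_continuous T).2 cT.
  have rE : r = (complex.Re r)%:C by rewrite RRe_real// gtr0_real.
  exists (complex.Re r ^+ 2) => [|u].
    by rewrite exprn_gt0// -ltcR -rE.
  rewrite -lecR -normN2 rmorphM rmorphXn /= -rE -normN2 -exprMn.
  by rewrite lerXn2r ?nnegrE ?normr_ge0// mulr_ge0// ltW.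
pose g u := B (T u) y.
pose J u := N2 u - 2 * g u.
have JD u w (t : R) : J (u + t%:C *: w) =
    J u + 2 * t * (B u w - g w) + t ^+ 2 * N2 w.
  have TE : T (u + t%:C *: w) = T u + t%:C *: T w by rewrite linearD linearZ.
  rewrite /J /g N2D N2Z (BC u) BZ (BC w u) TE BD BZ; ring.
have Jlb u : - (K * N2 y) <= J u.
  have := N2_ge0 (T u + (- K)%:C *: y).
  rewrite N2D N2Z (BC (T u)) BZ (BC y) /J -/(g u) => h.
  have := TK u; have := N2_ge0 u; have := N2_ge0 y; nra.
pose S := range J; pose m := inf S.
have Slb : has_lbound S by exists (- (K * N2 y)) => _ [u _ <-].
have Sn0 : S !=set0 by exists (J 0), 0.
have mJ u : m <= J u by apply: ge_inf => //; exists u.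
pose A (e : R) := [set u | J u < m + e].
have stat e u w : A e u -> (B u w - g w) ^+ 2 <= e * N2 w.
  move=> Au; apply: discr => // t.
  have := mJ (u + t%:C *: w); rewrite JD; move: Au; rewrite /A /=; lra.
have near2 e u v : A e u -> A e v -> N2 (u - v) <= 4 * e.
  move=> Au Av; set w := u - v.
  have := stat _ _ w Au; have := stat _ _ w Av => hv hu.
  have wE : N2 w = (B u w - g w) - (B v w - g w).
    by rewrite -[N2 w]/(B w w) {1}/w BD BN; ring.
  have [w0|] := eqVneq (N2 w) 0.
    by rewrite w0; have := mJ u; move: Au; rewrite /A /=; lra.
  move=> /negPf wn0; have w0 : 0 < N2 w by rewrite lt_def wn0 N2_ge0.
  have : N2 w ^+ 2 <= 4 * e * N2 w by rewrite {1}wE -mulrA; exact: sq2.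
  by rewrite expr2 ler_pM2r.
pose F := filter_from [set e : R | 0 < e] A.
have FF : ProperFilter F.
  apply: filter_from_proper; last first.
    move=> e /= e0; have [_ [u _ <-] ue] := inf_adherent e0 (conj Sn0 Slb).
    by exists u.
  apply: filter_from_filter; first by exists 1 => /=.
  move=> a b /= a0 b0; exists (Num.min a b); first by rewrite lt_min a0.
  move=> u; rewrite /A /= => h; split; apply: (lt_le_trans h);
    by rewrite lerD2l ge_min lexx ?orbT.
have ballE (u v : H) (e : R) : 0 < e -> ball u e%:C v <-> N2 (u - v) < e ^+ 2.
  move=> e0; rewrite -ball_normE /= -(@ltr_pXn2r _ 2) ?nnegrE//.
    by rewrite normN2 -rmorphXn ltcR.
  by rewrite ler0c ltW.
have Fc : cauchy F.
  apply: cauchy_exP => eps eps0.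
  have epsE : eps = (complex.Re eps)%:C by rewrite RRe_real// gtr0_real.
  set e := complex.Re eps in epsE; rewrite epsE.
  have e0 : 0 < e by rewrite -ltcR -epsE.
  have e8 : 0 < e ^+ 2 / 8 by rewrite divr_gt0// exprn_gt0.
  have [_ [u _ <-] ue] := inf_adherent e8 (conj Sn0 Slb).
  exists u, (e ^+ 2 / 8) => // v Av; apply/ballE => //.
  apply: le_lt_trans (near2 _ _ _ ue Av) _; nra.
have /cvg_ex[z Fz] : cvg F by exact: cauchy_cvg.
have key w : B z w = g w.
  suff h e : 0 < e -> (B z w - g w) ^+ 2 <= 4 * e * N2 w.
    apply/eqP; rewrite -subr_eq0 -sqrf_eq0 eq_le sqr_ge0 andbT.
    apply/ler_addgt0Pl => e e0; rewrite addr0.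
    have q0 : 0 < e / (4 * (N2 w + 1)).
      by rewrite divr_gt0// mulr_gt0// ltr_wpDl.
    apply: le_trans (h _ q0) _.
    have n1 : 0 < N2 w + 1 by rewrite ltr_wpDl.
    have -> : 4 * (e / (4 * (N2 w + 1))) * N2 w = e * (N2 w / (N2 w + 1)).
      by field; rewrite gt_eqF.
    rewrite ler_piMr ?ltW// ltr_pdivrMr// mul1r ltrDl//.
  move=> e0.
  have s0 : 0 < Num.sqrt e by rewrite sqrtr_gt0.
  have Fb : F (ball z (Num.sqrt e)%:C).
    by apply: Fz; apply: nbhsx_ballx; rewrite ltcR.
  have FA : F (A e) by exists e.
  have [u [/ballE hb Au]] := filter_ex (filterI Fb FA).
  have {hb} := hb s0; rewrite (sqr_sqrtr (ltW e0)) => hb.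
  have h1 := stat _ _ w Au; have := CS (z - u) w.
  rewrite BD BN => h2.
  have {h2} h2 : (B z w - B u w) ^+ 2 <= e * N2 w.
    by apply: le_trans h2 _; rewrite ler_wpM2r// ltW.
  have -> : B z w - g w = (B z w - B u w) - (g w - B u w) by ring.
  by rewrite -mulrA; apply: sq2; rewrite // -sqrrN opprB.
exists z => w.
apply/eqP; rewrite eq_complex; apply/andP; split; apply/eqP.
  by rewrite -[LHS]/(g w) -key BC.
have TE : T ('i *: w) = 'i *: T w by rewrite linearZ.
have := key ('i *: w); by rewrite /g TE BC !Bi => /oppr_inj ->.
Qed.
End Operators.

(* Main.v *)
(* With [c] ranging over unimodular scalars, |Re <c T x, x>| <= w(T) |x|^2, and
   polarization turns this into a bound of |Re(c T)| by w(T); so, for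
   a = |Re T| and b = |Im T|,
   w(T)^2 >= max(a^2, b^2) = (a^2 + b^2) / 2 + |a^2 - b^2| / 2.
   The parallelogram law gives
   |Tx|^2 + |T*x|^2 = 2 (|(Re T) x|^2 + |(Im T) x|^2) <= 2 (a^2 + b^2) |x|^2,
   whose left side is at least (1 + alpha^2) |Tx|^2 and (1 + 1/beta^2) |T*x|^2. *)
Require Import Defs.
From mathcomp Require Import all_boot all_order all_algebra.
From mathcomp Require Import sesquilinear complex.
From mathcomp Require Import ring lra.
From mathcomp Require Import all_classical all_reals all_analysis.

Import Order.TTheory GRing.Theory Num.Theory.
Import numFieldNormedType.Exports.

Local Open Scope classical_set_scope.
Local Open Scope ring_scope.

Lemma sup_ge0 (R : realType) (E : set R) :
  (forall r, E r -> 0 <= r) -> 0 <= sup E.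
Proof.
(* An empty or unbounded [E] has the default supremum 0. *)
move=> E0; have [hE|/sup_out ->//] := pselect (has_sup E).
have [[r Er] _] := hE.
by apply: le_trans (E0 r Er) _; apply: sup_upper_bound.
Qed.

(** * The real inner product Re <u, v> *)

Section RealInnerProduct.
Local Open Scope complex_scope.

Lemma Re_le_norm (R : rcfType) (z : R[i]) : complex.Re z <= complex.Re `|z|.
Proof.
have := normc_ge_Re z; rewrite normc_def lecR; apply: le_trans; exact: ler_norm.
Qed.

Context {R : realType} {H : hilbertType R}.
Implicit Types (u v w x y : H).

(** Real-valued forms of the inner product and the norm, so that estimates take place in the ordered
    field [R], within reach of [lra] and [nra]. *)
Definition rdot u v : R := complex.Re (hdot u v).
Definition rnorm u : R := complex.Re `|u|.

Lemma hdot_real u : hdot u u = (rdot u u)%:C.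
Proof. by rewrite /rdot RRe_real// ger0_real// dnorm_ge0. Qed.

Lemma rdot_ge0 u : 0 <= rdot u u.
Proof. by rewrite -ler0c -hdot_real dnorm_ge0. Qed.

Lemma rdotC u v : rdot u v = rdot v u.
Proof. by rewrite /rdot hdot_conj; case: (hdot v u). Qed.

Lemma rdotDl u v w : rdot (u + v) w = rdot u w + rdot v w.
Proof.
by rewrite /rdot linearDl /=; case: (hdot u w) => a b; case: (hdot v w).
Qed.

Lemma rdotNl u w : rdot (- u) w = - rdot u w.
Proof. by rewrite /rdot linearNl /=; case: (hdot u w). Qed.

Lemma rdotZl (t : R) u w : rdot (t%:C *: u) w = t * rdot u w.
Proof.
rewrite /rdot linearZl_LR /=; case: (hdot u w) => a b /=.
by rewrite mul0r subr0.
Qed.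

Lemma rdotDr u v w : rdot w (u + v) = rdot w u + rdot w v.
Proof. by rewrite !(rdotC w) rdotDl. Qed.

Lemma rdotNr u w : rdot w (- u) = - rdot w u.
Proof. by rewrite !(rdotC w) rdotNl. Qed.

Lemma rdotZr (t : R) u w : rdot w (t%:C *: u) = t * rdot w u.
Proof. by rewrite !(rdotC w) rdotZl. Qed.

Lemma rdotZZ (c : R[i]) u v : `|c| = 1 -> rdot (c *: u) (c *: v) = rdot u v.
Proof.
move=> c1; rewrite /rdot linearZl_LR /= linearZr_LR /= mulrA.
by rewrite -[c * _]sqr_normc c1 expr1n mul1r.
Qed.

Lemma rdot_eq0 u : rdot u u = 0 -> u = 0.
Proof.
by move=> h; apply/eqP; rewrite -normr_eq0 -sqrf_eq0 hdotE hdot_real h.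
Qed.

Lemma rnormE u : `|u| = (rnorm u)%:C.
Proof. by rewrite /rnorm RRe_real// ger0_real. Qed.

Lemma rnorm_ge0 u : 0 <= rnorm u.
Proof. by rewrite -ler0c -rnormE. Qed.

Lemma rnorm_sqr u : rnorm u ^+ 2 = rdot u u.
Proof.
by apply: (@complexI R); rewrite rmorphXn /= -rnormE hdotE hdot_real.
Qed.

Lemma rnorm_le (a : R) u : 0 <= a -> (rnorm u <= a) = (rdot u u <= a ^+ 2).
Proof. by move=> a0; rewrite -rnorm_sqr ler_pXn2r// nnegrE ?rnorm_ge0. Qed.

Lemma rdot_cauchy_schwarz u v : rdot u v ^+ 2 <= rdot u u * rdot v v.
Proof.
have := rdot_ge0 v; rewrite le_eqVlt => /orP[/eqP v0|v0].
  rewrite -v0 mulr0 (rdot_eq0 _ (esym v0)).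
  by rewrite -[X in rdot _ X](scale0r u) (rdotZr 0) mul0r expr0n.
(* This vector is [rdot v v] times the component of [u] orthogonal to [v]. *)
have := rdot_ge0 ((rdot v v)%:C *: u - (rdot u v)%:C *: v).
rewrite rdotDl rdotNl !rdotDr !rdotNr !rdotZl !rdotZr (rdotC v u).
rewrite (_ : _ + _ = rdot v v * (rdot u u * rdot v v - rdot u v ^+ 2));
  last by ring.
by rewrite pmulr_rge0// subr_ge0.
Qed.

(** A nonzero [x] is rescaled to the unit sphere; at [x = 0], homogeneity with [t = 0] gives
    [f 0 = 0]. *)
Lemma sphere_homogeneous (f : H -> R) (M : R) :
  (forall (t : R) x, f (t%:C *: x) = t ^+ 2 * f x) ->
  (forall x, rdot x x = 1 -> f x <= M) ->
  forall x, f x <= M * rdot x x.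
Proof.
move=> fZ fM x; have := rdot_ge0 x; rewrite le_eqVlt => /orP[/eqP x0|x0].
  rewrite -x0 mulr0 (rdot_eq0 _ (esym x0)).
  by rewrite -(scale0r x) (fZ 0) expr0n mul0r.
have n0 : rnorm x != 0 by rewrite -sqrf_eq0 rnorm_sqr gt_eqF.
have := fM ((rnorm x)^-1%:C *: x); rewrite fZ rdotZl rdotZr -rnorm_sqr.
rewrite exprVn mulrA -expr2 exprVn mulVf ?expf_neq0// => /(_ erefl).
by rewrite mulrC ler_pdivrMr// rnorm_sqr.
Qed.

(** * Operator norm and numerical radius as pointwise bounds *)

Lemma op_norm_ge0 (A : H -> H) : 0 <= op_norm A.
Proof. by apply: sup_ge0 => _ [x _ <-]; exact: rnorm_ge0. Qed.

Lemma op_norm_le (A : H -> H) (M : R) : 0 <= M ->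
  (forall x, rdot (A x) (A x) <= M ^+ 2 * rdot x x) ->
  op_norm A <= M.
Proof.
move=> M0 hM; apply: ge_sup.
  by exists (rnorm (A 0)), 0; rewrite //= normr0.
move=> _ [x /= x1 <-]; rewrite -/(rnorm _) rnorm_le//.
apply: le_trans (hM x) _; rewrite ler_piMr ?sqr_ge0//.
by move: x1; rewrite rnormE lecR rnorm_le// expr1n.
Qed.

(** The constant [M] makes the set under [sup] bounded, so that [op_norm A] is a true upper bound
    and not the default 0. *)
Lemma op_norm_bound (A : H -> H) (M : R) : 0 <= M ->
  (forall (t : R) x, A (t%:C *: x) = t%:C *: A x) ->
  (forall x, rdot (A x) (A x) <= M ^+ 2 * rdot x x) ->
  forall x, rdot (A x) (A x) <= op_norm A ^+ 2 * rdot x x.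
Proof.
move=> M0 AZ hM; apply: sphere_homogeneous => [t x|x x1].
  by rewrite AZ rdotZl rdotZr mulrA.
rewrite -rnorm_le ?op_norm_ge0//; apply: ub_le_sup; last first.
  by exists x => //=; rewrite rnormE lecR rnorm_le// x1 expr1n.
exists M => _ [y /= y1 <-]; rewrite -/(rnorm _) rnorm_le//.
apply: le_trans (hM y) _; rewrite ler_piMr ?sqr_ge0//.
by move: y1; rewrite rnormE lecR rnorm_le// expr1n.
Qed.

Lemma linear_rdot_bounded (T : {linear H -> H}) : continuous T ->
  exists2 K : R, 0 < K & forall x, rdot (T x) (T x) <= K ^+ 2 * rdot x x.
Proof.
move/(linear_bounded_continuous T).2 => /linear_boundedP.
move=> /pinfty_ex_gt0[r r0 hr].
have rE : r = (complex.Re r)%:C by rewrite RRe_real// gtr0_real.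
have K0 : 0 < complex.Re r by rewrite -ltcR -rE.
exists (complex.Re r) => // x; rewrite -rnorm_sqr -rnorm_sqr -exprMn.
rewrite ler_pXn2r ?nnegrE ?mulr_ge0 ?rnorm_ge0 ?(ltW K0)//.
by have := hr x; rewrite !rnormE {1}rE -rmorphM lecR.
Qed.

Lemma num_radius_bound (T : {linear H -> H}) : continuous T ->
  0 <= num_radius T /\
  forall (c : R[i]) x, `|c| = 1 ->
    rdot (c *: T x) x <= num_radius T * rdot x x.
Proof.
move=> /linear_rdot_bounded[K K0 hK].
(* Cauchy-Schwarz is applied to the real and imaginary parts separately, the latter being
   [rdot ('i *: u) v] up to sign. The resulting factor 2 is harmless: the bound only shows that the
   set defining [num_radius] is bounded above. *)
have rhdot u v : complex.Re `|hdot u v| ^+ 2 <= 2 * (rdot u u * rdot v v).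
  rewrite normc_def /= sqr_sqrtr ?addr_ge0 ?sqr_ge0//.
  have := rdot_cauchy_schwarz u v; have := rdot_cauchy_schwarz ('i *: u) v.
  have i1 : `|'i : R[i]| = 1 by rewrite normc_def /= expr0n expr1n add0r sqrtr1.
  rewrite rdotZZ// {1 4}/rdot linearZl_LR /=; case: (hdot u v) => a b /=.
  by rewrite mul0r mul1r sub0r sqrrN; lra.
have lub x : rdot x x = 1 -> complex.Re `|hdot (T x) x| <= num_radius T.
  move=> x1; apply: ub_le_sup; last first.
    exists x => //=; apply/eqP; rewrite rnormE.
    rewrite (_ : rnorm x = 1)//; apply/eqP.
    by rewrite -sqrp_eq1 ?rnorm_ge0// rnorm_sqr x1.
  exists (2 * K) => _ [y /= y1 <-].
  have yy : rdot y y = 1.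
    by apply: (@complexI R); rewrite -hdot_real -hdotE y1 expr1n.
  rewrite -(@ler_pXn2r _ 2)// ?nnegrE ?mulr_ge0 ?(ltW K0)//; last first.
    by case: (hdot _ _) => p q; rewrite /= sqrtr_ge0.
  apply: le_trans (rhdot _ _) _; rewrite yy mulr1 exprMn.
  by have := hK y; rewrite yy mulr1; have := rdot_ge0 (T y); lra.
split.
  apply: sup_ge0 => _ [y _ <-].
  by case: (hdot _ _) => p q; rewrite /= sqrtr_ge0.
move=> c x c1; move: x; apply: sphere_homogeneous => [t x|x x1].
  by rewrite linearZ /= scalerA mulrC -scalerA rdotZl rdotZr mulrA.
apply: le_trans (lub x x1); rewrite /rdot linearZl_LR.
have -> : `|hdot (T x) x| = `|c * hdot (T x) x| by rewrite normrM c1 mul1r.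
exact: Re_le_norm.
Qed.

End RealInnerProduct.

(** * Real parts of the rotated operators c T *)

Section Symmetrization.
Local Open Scope complex_scope.
Context {R : realType} {H : hilbertType R}.
Variables (T : {linear H -> H}).
Hypothesis cT : continuous T.

(* [op_Re T] is the case [c = 1] and [op_Im T] the case [c = - 'i]. *)
Definition rotated_Re (c : R[i]) (x : H) : H :=
  (2^-1 : R)%:C *: (c *: T x + c^*%C *: adjoint T x).

(** Moving the adjoint across and conjugating turns the second summand into Re <c T y, x>. This weak
    form lets the next lemmas avoid [adjoint]. *)
Lemma rotated_Re_dot (c : R[i]) x y :
  2 * rdot (rotated_Re c x) y = rdot (c *: T x) y + rdot (c *: T y) x.
Proof.
rewrite /rotated_Re rdotZl rdotDl mulrA divff ?mul1r ?pnatr_eq0//.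
congr (_ + _).
rewrite /rdot !linearZl_LR /= (adjointP cT) (hdot_conj y) /=.
by case: (hdot _ y) => a b; case: c => p q /=; ring.
Qed.

(** Since [adjoint] is defined by choice, homogeneity is read off the weak form: the difference [z]
    of the two sides is orthogonal to itself. *)
Lemma rotated_ReZ (c : R[i]) (t : R) x :
  rotated_Re c (t%:C *: x) = t%:C *: rotated_Re c x.
Proof.
apply/eqP; rewrite -subr_eq0; apply/eqP/rdot_eq0; set z := _ - _.
rewrite {1}/z rdotDl rdotNl (rdotZl t).
have := rotated_Re_dot c x z; have := rotated_Re_dot c (t%:C *: x) z.
rewrite linearZ /= scalerA (mulrC c) -scalerA (rdotZl t (c *: T x)) rdotZr.
nra.
Qed.

(* Polarization at [x + s A x] and [x - s A x] gives
   [2 s |Ax|^2 <= w (|x|^2 + s^2 |Ax|^2)]; choose [s = 1 / w]. *)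
Lemma rotated_Re_bound (c : R[i]) x : `|c| = 1 ->
  rdot (rotated_Re c x) (rotated_Re c x) <= num_radius T ^+ 2 * rdot x x.
Proof.
move=> c1; have := rotated_Re_dot c x (rotated_Re c x).
move: (rotated_Re c x) => y dotE.
have [] := num_radius_bound T cT; set w := num_radius T => w0 hw.
have key (s : R) : 2 * s * rdot y y <= w * (rdot x x + s ^+ 2 * rdot y y).
  have cN1 : `|- c| = 1 by rewrite normrN.
  have cTZ : c *: T (s%:C *: y) = s%:C *: (c *: T y).
    by rewrite linearZ /= !scalerA mulrC.
  (* The sign of [- c] cancels the diagonal terms; the cross terms add up to 4 s |y|^2 by [dotE]. *)
  have := hw c (x + s%:C *: y) c1; have := hw (- c) (x - s%:C *: y) cN1.
  rewrite (raddfB T) (raddfD T) scaleNr scalerBr scalerDr cTZ.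
  rewrite !(rdotDl, rdotDr, rdotNl, rdotNr, rdotZl, rdotZr) (rdotC y x); nra.
(* If [w = 0], then [s = 1] already forces |y| = 0. *)
move: w0; rewrite le_eqVlt => /orP[/eqP w0|w0].
  by have := key 1; rewrite -w0 expr0n /= !mul0r; lra.
have := key w^-1; rewrite -(ler_pM2l w0).
have -> : w * (2 * w^-1 * rdot y y) = 2 * rdot y y.
  by field; rewrite gt_eqF.
have -> : w * (w * (rdot x x + w^-1 ^+ 2 * rdot y y)) =
    w ^+ 2 * rdot x x + rdot y y.
  by field; rewrite gt_eqF.
lra.
Qed.

Lemma rotated_Re_op_norm (c : R[i]) : `|c| = 1 ->
  op_norm (rotated_Re c) <= num_radius T /\
  forall x, rdot (rotated_Re c x) (rotated_Re c x) <=
    op_norm (rotated_Re c) ^+ 2 * rdot x x.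
Proof.
move=> c1; have [w0 _] := num_radius_bound T cT.
have bd x := rotated_Re_bound c x c1.
split; first exact: op_norm_le w0 bd.
by apply: op_norm_bound w0 _ bd => t x; exact: rotated_ReZ.
Qed.

Lemma half_complex : 2^-1 = (2^-1 : R)%:C :> R[i].
Proof. by rewrite fmorphV rmorph_nat. Qed.

Lemma inv_2i : (2 * 'i)^-1 = (2^-1 : R)%:C * - 'i :> R[i].
Proof.
rewrite invfM half_complex; congr (_ * _); apply/eqP.
by rewrite eq_complex /= mul0r expr0n expr1n add0r divr1 eqxx oppr0 eqxx.
Qed.

Lemma op_ReE : op_Re T = rotated_Re 1.
Proof.
apply/funext => x; rewrite /rotated_Re.
have -> : (1 : R[i])^* = 1 by apply/eqP; rewrite eq_complex /= oppr0 !eqxx.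
by rewrite !scale1r -half_complex.
Qed.

Lemma op_ImE : op_Im T = rotated_Re (- 'i).
Proof.
apply/funext => x; rewrite /rotated_Re.
have -> : (- 'i : R[i])^* = - (- 'i).
  by apply/eqP; rewrite eq_complex /= !oppr0 !eqxx.
by rewrite (scaleNr (- 'i)) -scalerBr scalerA -inv_2i.
Qed.

(** The factor [- 'i] inside [op_Im T] has modulus 1 and drops out, leaving the parallelogram law
    for T x and T* x. *)
Lemma parallelogram x :
  rdot (op_Re T x) (op_Re T x) + rdot (op_Im T x) (op_Im T x) =
  (rdot (T x) (T x) + rdot (adjoint T x) (adjoint T x)) / 2.
Proof.
have i1 : `|- 'i : R[i]| = 1.
  by rewrite normrN normc_def /= expr0n expr1n add0r sqrtr1.
have -> : op_Re T x = (2^-1 : R)%:C *: (T x + adjoint T x).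
  by rewrite -half_complex.
have -> : op_Im T x = - 'i *: ((2^-1 : R)%:C *: (T x - adjoint T x)).
  by rewrite scalerA mulrC -inv_2i.
rewrite (rdotZZ (- 'i))// !(rdotZl, rdotZr, rdotDl, rdotDr, rdotNl, rdotNr).
rewrite (rdotC (adjoint T x) (T x)); by field.
Qed.

(** By Cauchy-Schwarz, |Tx|^4 = <x, T* T x>^2 <= |x|^2 M |Tx|^2; then |Tx|^2 cancels unless it is
    0. *)
Lemma adjoint_bound (M : R) : 0 <= M ->
  (forall x, rdot (adjoint T x) (adjoint T x) <= M * rdot x x) ->
  forall x, rdot (T x) (T x) <= M * rdot x x.
Proof.
move=> M0 hM x.
have := rdot_cauchy_schwarz x (adjoint T (T x)).
rewrite {1}/rdot -(adjointP cT) -/(rdot _ _) => h.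
have := hM (T x); have := rdot_ge0 x; have := rdot_ge0 (T x).
rewrite le_eqVlt => /orP[/eqP <- x0 _|t0 x0 h2]; first by rewrite mulr_ge0.
by rewrite -(ler_pM2r t0); nra.
Qed.

(** Pairing with [x] gives <T* T x, x> = |Tx|^2 and <T T* x, x> = |T* x|^2. *)
Lemma ab_normal_rdot (alpha beta : R) x : ab_normal alpha beta T ->
  alpha ^+ 2 * rdot (T x) (T x) <= rdot (adjoint T x) (adjoint T x) /\
  rdot (adjoint T x) (adjoint T x) <= beta ^+ 2 * rdot (T x) (T x).
Proof.
have TsT y : rdot (adjoint T (T y)) y = rdot (T y) (T y).
  by rewrite rdotC /rdot (adjointP cT).
have TTs y : rdot (T (adjoint T y)) y = rdot (adjoint T y) (adjoint T y).
  by rewrite /rdot (adjointP cT).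
have pos (z : R[i]) : 0 <= z -> 0 <= complex.Re z by rewrite lecE => /andP[].
move=> [/(_ x)/pos + /(_ x)/pos].
by rewrite -!/(rdot _ _) !(rdotDl, rdotNl, rdotZl) /= !TsT !TTs !subr_ge0.
Qed.

End Symmetrization.

(** * Combination of the estimates *)

Theorem theorem3p1 (R : realType) (H : hilbertType R) (alpha beta : R)
    (T : {linear H -> H}) :
  0 <= alpha <= 1 -> 1 <= beta -> continuous T -> ab_normal alpha beta T ->
  num_radius T ^+ 2 >=
    Num.max (1 + alpha ^+ 2) (1 + 1 / beta ^+ 2) * (op_norm T ^+ 2 / 4)
    + `| op_norm (op_Re T) ^+ 2 - op_norm (op_Im T) ^+ 2 | / 2.
Proof.
move=> _ b1 cT abT.
have one1 : `|1 : R[i]%C| = 1 by exact: normr1.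
have i1 : `|- 'i%C : R[i]%C| = 1.
  by rewrite normrN normc_def /= expr0n expr1n add0r sqrtr1.
have [] := rotated_Re_op_norm T cT _ one1.
have [] := rotated_Re_op_norm T cT _ i1.
rewrite -op_ReE -op_ImE.
set a := op_norm (op_Re T); set b := op_norm (op_Im T); set w := num_radius T.
move=> bw hb aw ha.
have sum x : rdot (T x) (T x) + rdot (adjoint T x) (adjoint T x) <=
    2 * (a ^+ 2 + b ^+ 2) * rdot x x.
  by have := parallelogram T x; have := ha x; have := hb x; lra.
have bound (k : R) : 0 < k ->
    (forall x, k * rdot (T x) (T x) <= 2 * (a ^+ 2 + b ^+ 2) * rdot x x) ->
    k * op_norm T ^+ 2 <= 2 * (a ^+ 2 + b ^+ 2).
  move=> k0 h; set S := 2 * _ in h *.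
  have S0 : 0 <= S / k by rewrite divr_ge0 ?mulr_ge0 ?addr_ge0 ?sqr_ge0// ltW.
  have tS : op_norm T <= Num.sqrt (S / k).
    apply: op_norm_le => [|x]; first exact: sqrtr_ge0.
    by rewrite sqr_sqrtr// mulrAC ler_pdivlMr// mulrC.
  rewrite mulrC -ler_pdivlMr// -(sqr_sqrtr S0) ler_pXn2r//.
    by rewrite nnegrE op_norm_ge0.
  by rewrite nnegrE sqrtr_ge0.
have sum0 : 0 <= 2 * (a ^+ 2 + b ^+ 2) by rewrite mulr_ge0 ?addr_ge0 ?sqr_ge0.
have ka : 0 < 1 + alpha ^+ 2 by rewrite ltr_wpDr ?sqr_ge0.
have b20 : 0 < beta ^+ 2 by rewrite exprn_gt0// (lt_le_trans ltr01).
have kb : 0 < 1 + 1 / beta ^+ 2 by rewrite ltr_wpDr// divr_ge0// ltW.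
have hk : Num.max (1 + alpha ^+ 2) (1 + 1 / beta ^+ 2) * op_norm T ^+ 2 <=
    2 * (a ^+ 2 + b ^+ 2).
  have [_|_] := leP (1 + alpha ^+ 2) (1 + 1 / beta ^+ 2); apply: bound => // x.
    (* Normality with [beta] bounds T* rather than T, so [adjoint_bound] carries the estimate over
       to T. *)
    move: x; suff h y : rdot (T y) (T y) <=
        2 * (a ^+ 2 + b ^+ 2) / (1 + 1 / beta ^+ 2) * rdot y y.
      by move=> x; have := h x; rewrite mulrAC ler_pdivlMr// mulrC.
    move: y; apply: adjoint_bound => //; first by rewrite divr_ge0// ltW.
    move=> x; rewrite mulrAC ler_pdivlMr//; apply: le_trans (sum x).
    have [_ h] := ab_normal_rdot T cT _ _ x abT.
    by rewrite mulrDr mulr1 addrC lerD2r mul1r ler_pdivrMr// mulrC.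
  have [h _] := ab_normal_rdot T cT _ _ x abT.
  by rewrite mulrDl mul1r; apply: le_trans (sum x); rewrite lerD2l.
have w0 : 0 <= w by have [] := num_radius_bound T cT.
have aw2 : a ^+ 2 <= w ^+ 2 by rewrite ler_pXn2r// nnegrE op_norm_ge0.
have bw2 : b ^+ 2 <= w ^+ 2 by rewrite ler_pXn2r// nnegrE op_norm_ge0.
(* By [hk] the first term is at most (a^2 + b^2) / 2; with the second it makes at most max(a^2,
   b^2), and the sign of a^2 - b^2 decides which square is compared with w^2. *)
rewrite mulrA; have [_|_] := ger0P (a ^+ 2 - b ^+ 2); lra.
Qed.
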